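(* Let $\pi$ be a permutation of $[n]$ and let $L, L'$ be two cyclic ladder lotteries in $\mathcal{L}^1(\pi)$. Then $\mathit{DV}(L)=\mathit{DV}(L')$ if and only if $L$ and $L'$ are reachable from each other under braid relations, i.e. there is a reconfiguration sequence under braid relations between $L$ and $L'$.
   Context: Let $[n]=\{1,\dots,n\}$ and let $\pi=(\pi_1,\dots,\pi_n)$ be a permutation of $[n]$. A cyclic ladder lottery $L$ of $\pi$ consists of $n$ vertical lines (line $1,\dots,n$ from left to right) and finitely many horizontal bars at distinct heights. Each bar connects two cyclically adjacent lines: lines $k$ and $k+1$ for some $1\le k\le n-1$, or lines $n$ and $1$. Place element $i$ at the top of line $i$ and sweep downward; each bar swaps the two elements currently on its lines. It is required that at the bottom, line $j$ carries $\pi_j$ for every $j$. The route of element $i$ is the pseudoline $\mathrm{pl}(L,i)$. Drawing the lines on a cylinder (so that lines $n$ and $1$ are adjacent), $L$ is an arrangement of $n$ $y$-monotone pseudolines on the cylinder, and each bar is an intersection point of two pseudolines. Cyclic ladder lotteries are regarded as pseudoline arrangements, i.e. identified when along every pseudoline the same pseudolines are crossed in the same order. $\mathcal{L}^1(\pi)$ is the set of cyclic ladder lotteries of $\pi$ in which any two pseudolines cross at most once. The displacement vector $\mathit{DV}(L)=(x_1,\dots,x_n)\in\mathbb{Z}^n$ is defined as follows. $x_i$ is the number of bars at which element $i$ moves one line to the right (from line $k$ to $k+1$, or from line $n$ to line $1$), minus the number of bars at which it moves one line to the left. Let $L\in\mathcal{L}^1(\pi)$. For distinct $i,j,k$, the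 triple $\{i,j,k\}$ is tangled if the three pseudolines pairwise cross. Restricting to these three pseudolines, let $p$ be the intersection adjacent to two top endpoints, $q$ the intersection adjacent to one top and one bottom endpoint, and $r$ the intersection adjacent to two bottom endpoints. The triple is left tangled if $p,q,r$ appear in counterclockwise order on the boundary of the region enclosed by the three pseudolines, and right tangled if they appear in clockwise order. A tangled triple is minimal if that region contains no part of any other pseudoline of $L$. A braid relation transforms a minimal left tangled triple into a minimal right tangled triple, or vice versa, by passing one of the three pseudolines across the intersection of the other two. In terms of bars, this replaces three consecutive bars on lines $k,k+1$, then $k+1,k+2$, then $k,k+1$ by bars on $k+1,k+2$, then $k,k+1$, then $k+1,k+2$ (indices mod $n$), or the reverse. A reconfiguration sequence under braid relations between $L$ and $L'$ is a sequence $L=L_0,L_1,\dots,L_t=L'$ in which each $L_{s}$ is obtained from $L_{s-1}$ by one braid relation.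
   Formalization: Two lotteries are identified only if each crossing also takes place from the same side; for n ≥ 3 this is automatic, but for n = 2, π = (2,1), the two one-bar lotteries have different DV and would otherwise be identified, making the claim false. *)

(* Defs.v *)
From mathcomp Require Import all_boot all_order all_algebra all_fingroup.

Set Implicit Arguments.
Unset Strict Implicit.
Unset Printing Implicit Defensive.

Import GRing.Theory Num.Theory.

(* Lines and elements are both indexed by 'I_n = {0, ..., n-1}.  A diagram is
   the sequence of its bars from top to bottom; the bar k : 'I_n connects line k
   to line ordS k, so the last line is joined to line 0.  For n = 2 the bars
   0 and 1 join the same two lines on opposite sides of the cylinder. *)
Definition diagram (n : nat) := seq 'I_n.

(* The elements carried by the lines are recorded as a permutation s, where
   s j is the element on line j.  In MathComp (u * v) j = v (u j), so the new
   s exchanges the elements on lines k and ordS k. *)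
Definition apply_bar n (s : 'S_n) (k : 'I_n) : 'S_n :=
  (tperm k (ordS k) * s)%g.

Definition bottom n (L : diagram n) : 'S_n := foldl (@apply_bar n) 1%g L.

(* The condition k != ordS k only matters for n = 1, where it excludes a bar
   joining the unique line to itself. *)
Definition is_lottery n (pi : 'S_n) (L : diagram n) : Prop :=
  all (fun k => k != ordS k) L /\ bottom L = pi.

(* The bars from top to bottom, each given as the pair (a, b) of the elements
   it swaps, where a moves one line to the right and b one line to the left. *)
Fixpoint crossings_from n (s : 'S_n) (L : diagram n) : seq ('I_n * 'I_n) :=
  if L is k :: L' then
    (s k, s (ordS k)) :: crossings_from (apply_bar s k) L'
  else [::].

Definition crossings n (L : diagram n) : seq ('I_n * 'I_n) :=
  crossings_from 1%g L.

Definition pl n (L : diagram n) (i : 'I_n) : seq ('I_n * 'I_n) :=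
  [seq c <- crossings L | (c.1 == i) || (c.2 == i)].

(* Along every pseudoline the same pseudolines are crossed in the same order.
   The pairs in pl also record from which side each crossing takes place.  For
   n >= 3 this is no extra information: two elements are never adjacent on both
   sides.  For n = 2 it separates the two diagrams with a single bar, which are
   different arrangements on the cylinder. *)
Definition same_arrangement n (L L' : diagram n) : Prop :=
  forall i : 'I_n, pl L i = pl L' i.

Definition cross_count n (L : diagram n) (i j : 'I_n) : nat :=
  count (fun c => (c == (i, j)) || (c == (j, i))) (crossings L).

Definition in_LL1 n (pi : 'S_n) (L : diagram n) : Prop :=
  is_lottery pi L /\ forall i j : 'I_n, i != j -> cross_count L i j <= 1.

Definition DV n (L : diagram n) : 'rV[int]_n :=
  (\row_i ((count (fun c => c.1 == i) (crossings L))%:Z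
           - (count (fun c => c.2 == i) (crossings L))%:Z))%R.

(* The three pseudolines on lines k, k+1, k+2 bound an empty triangle; the two
   sides are its two orientations.  The condition 2 < n makes these lines
   distinct. *)
Definition braid_bars n (L L' : diagram n) : Prop :=
  2 < n /\
  exists (u v : diagram n) (k : 'I_n),
    L = u ++ [:: k; ordS k; k] ++ v /\
    L' = u ++ [:: ordS k; k; ordS k] ++ v.

(* One braid relation, in either direction, between arrangements: the three
   bars need only be consecutive in some diagram of the arrangement. *)
Definition braid_relation n (L L' : diagram n) : Prop :=
  exists M M' : diagram n,
    [/\ same_arrangement L M,
        braid_bars M M' \/ braid_bars M' M &
        same_arrangement M' L'].

(* The sequence L_0, ..., L_t is Ls 0, ..., Ls t; its endpoints are L and L'
   as arrangements. *)
Definition reachable n (pi : 'S_n) (L L' : diagram n) : Prop :=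
  exists (t : nat) (Ls : nat -> diagram n),
    [/\ forall s, s <= t -> in_LL1 pi (Ls s),
        same_arrangement L (Ls 0),
        same_arrangement (Ls t) L' &
        forall s, s < t -> braid_relation (Ls s) (Ls s.+1)].

(* Main.v *)
Require Import Defs.
From mathcomp Require Import all_boot all_order all_algebra all_fingroup.
From mathcomp Require Import ring zify.

(* This is Matsumoto's theorem for the affine symmetric group, where lotteries in
   which two pseudolines cross at most once are reduced words.  Along a diagram
   the cyclic distance from a to b changes by the displacement of b minus that of
   a, plus n times the signed number of crossings of a and b; so the displacement
   vector and pi determine which pairs cross, and in which direction.  Hence the
   first bar k of L' swaps two elements that also cross in L.  By induction on its
   length, L can be rewritten so as to start with k: if its first bar is far from
   k, it commutes with k; if it is adjacent to k, it brings a third element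
   between the two, which one of them must cross before they meet, so that L can be
   rewritten to start with three bars to which a braid relation applies. *)

Set Implicit Arguments.
Unset Strict Implicit.
Unset Printing Implicit Defensive.

Section Braids.

Variable n : nat.
Implicit Types (s : 'S_n) (L M N u v : diagram n) (a b c e j k p q r : 'I_n).

(** * Bars as adjacent transpositions of cyclically ordered lines *)

Lemma val_ordS k : ordS k = (if k.+1 == n then 0 else k.+1) :> nat.
Proof.
have kn := ltn_ord k; rewrite /=; case: eqP => [->|ne]; first by rewrite modnn.
by rewrite modn_small //; lia.
Qed.

Lemma neq_ordS k : 1 < n -> k != ordS k.
Proof.
move=> n1; apply/eqP => /(congr1 (@nat_of_ord n)); rewrite val_ordS.
by have := ltn_ord k; case: eqP; lia.
Qed.

Lemma neq_ordSS k : 2 < n -> k != ordS (ordS k).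
Proof.
move=> n2; apply/eqP => /(congr1 (@nat_of_ord n)); rewrite !val_ordS.
by have := ltn_ord k; case: eqP; case: eqP; lia.
Qed.

Lemma apply_barE s k p : apply_bar s k p = s (tperm k (ordS k) p).
Proof. by rewrite permM. Qed.

Lemma apply_bar_inv s k a :
  ((apply_bar s k)^-1)%g a = tperm k (ordS k) ((s^-1)%g a).
Proof. by rewrite invMg tpermV permM. Qed.

Lemma crossings_from_cat s u v :
  crossings_from s (u ++ v)
  = crossings_from s u ++ crossings_from (foldl (@apply_bar n) s u) v.
Proof. by elim: u s => //= k u IHu s; rewrite IHu. Qed.

Lemma apply_bar_comm s j k :
  j != k -> j != ordS k -> ordS j != k ->
  apply_bar (apply_bar s j) k = apply_bar (apply_bar s k) j.
Proof.
move=> jk jSk Sjk; rewrite /apply_bar !mulgA; congr (_ * s)%g.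
have SjSk : ordS j != ordS k by rewrite (inj_eq (@ordS_inj n)).
by rewrite conjgC tpermJ !tpermD.
Qed.

(** Conjugating either of the two adjacent transpositions by the other gives the transposition of
    [k] and [ordS (ordS k)]. *)
Lemma apply_bar_braid s k :
  2 < n ->
  apply_bar (apply_bar (apply_bar s k) (ordS k)) k
  = apply_bar (apply_bar (apply_bar s (ordS k)) k) (ordS k).
Proof.
move=> n2; rewrite /apply_bar !mulgA; congr (_ * s)%g.
have k1 : k != ordS k by apply/neq_ordS/ltnW.
have k2 : ordS k != ordS (ordS k) by apply/neq_ordS/ltnW.
have k3 := neq_ordSS k n2.
have := tpermJ k (ordS k) (tperm (ordS k) (ordS (ordS k))).
have := tpermJ (ordS k) (ordS (ordS k)) (tperm k (ordS k)).
rewrite [X in _ = tperm X _]tpermR [X in _ = tperm _ X]tpermD //.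
rewrite [X in _ -> _ = tperm X _ -> _]tpermD 1?eq_sym //.
rewrite [X in _ -> _ = tperm _ X -> _]tpermL => <-.
by rewrite !conjgE !tpermV !mulgA => ->.
Qed.

(** * Cyclic distances and displacements *)

Lemma ord_eqE p q : (p == q) = (p == q :> nat).
Proof. by []. Qed.

Lemma val_tperm j k p :
  tperm j k p =
  (if p == j :> nat then k : nat else if p == k :> nat then j : nat else p) :> nat.
Proof. by rewrite permE /= !ord_eqE; do 2?case: ifP. Qed.

(* The number of steps to the right that lead from a to b. *)
Definition gap s a b : int :=
  let p := (s^-1)%g a in let q := (s^-1)%g b in
  (Posz q - Posz p + if (q < p)%N then Posz n else 0)%R.

Definition displacement (C : seq ('I_n * 'I_n)) e : int :=
  (Posz (count (fun x => x.1 == e) C) - Posz (count (fun x => x.2 == e) C))%R.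

Lemma permV_eq s a k : (s k == a) = ((s^-1)%g a == k).
Proof. by rewrite -{1}[a](permKV s) (inj_eq perm_inj) eq_sym. Qed.

(** The gap of distinct elements stays between 1 and n - 1, so it follows their moves except when
    they swap: then 1 would become -1, or n - 1 would become n + 1, and n corrects this. *)
Lemma gap_apply_bar s k a b :
  1 < n -> a != b ->
  gap (apply_bar s k) a b =
  (gap s a b + (Posz (s k == b) - Posz (s (ordS k) == b))
   - (Posz (s k == a) - Posz (s (ordS k) == a))
   + (if (s k, s (ordS k)) == (a, b) then Posz n else 0)
   - (if (s k, s (ordS k)) == (b, a) then Posz n else 0))%R.
Proof.
move=> n1 ab; rewrite /gap !apply_bar_inv !xpair_eqE !(permV_eq s) !val_tperm !ord_eqE.
have : (s^-1)%g a != (s^-1)%g b by rewrite (inj_eq perm_inj).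
move: ((s^-1)%g a) ((s^-1)%g b) => p q; rewrite ord_eqE.
have := neq_ordS k n1; rewrite ord_eqE val_ordS.
have := ltn_ord p; have := ltn_ord q; have := ltn_ord k.
move: (nat_of_ord p) (nat_of_ord q) (nat_of_ord k) => {}p {}q {}k.
set k' := (if k.+1 == n then _ else _) => kn.
have vk : k.+1 = n /\ k' = 0 \/ k.+1 < n /\ k' = k.+1.
  by rewrite /k'; case: eqP; lia.
move: k' vk => k' vk qn pn kk' pq.
do ?[case: eqP => ? /=]; do ?[case: ltnP => ? /=].
all: lia.
Qed.

Lemma gap_foldl s L a b :
  1 < n -> a != b ->
  gap (foldl (@apply_bar n) s L) a b =
  (gap s a b + displacement (crossings_from s L) b
   - displacement (crossings_from s L) a
   + Posz n * (Posz (count_mem (a, b) (crossings_from s L))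
               - Posz (count_mem (b, a) (crossings_from s L))))%R.
Proof.
move=> n1 ab; elim: L s => [|k L IHL] s /=; first by rewrite /displacement /=; lia.
rewrite IHL gap_apply_bar // /displacement /= !PoszD.
by case: ((s k, _) == (a, b)); case: ((s k, _) == (b, a)); rewrite /=; ring.
Qed.


(** * Cyclic order and forced crossings *)

Definition cyclic_order (p q r : nat) :=
  (p < q < r) || (q < r < p) || (r < p < q).

(** A bar can reverse the cyclic order of three positions only by swapping two of them. With [q]
    just left of [p] there would be no room for [r] between them, so only three swaps have to be
    excluded. *)
Lemma cyclic_order_tperm k p q r :
  cyclic_order p q r ->
  ~~ ((p == k) && (q == ordS k)) -> ~~ ((q == k) && (r == ordS k)) ->
  ~~ ((r == k) && (p == ordS k)) ->
  cyclic_order (tperm k (ordS k) p) (tperm k (ordS k) q) (tperm k (ordS k) r).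
Proof.
rewrite !val_tperm !ord_eqE val_ordS /cyclic_order.
have := ltn_ord p; have := ltn_ord q; have := ltn_ord r; have := ltn_ord k.
move: (nat_of_ord p) (nat_of_ord q) (nat_of_ord r) (nat_of_ord k) => {}p {}q {}r {}k.
case: (k.+1 =P n) => Sk kn rn qn pn; do ?[case: eqP => ? /=].
all: lia.
Qed.

(* As long as c stays between a and b, no bar can swap a with b while moving a to
   the right. *)
Lemma crossings_from_sandwich s L a b c :
  cyclic_order ((s^-1)%g a) ((s^-1)%g c) ((s^-1)%g b) ->
  (a, b) \in crossings_from s L -> (b, a) \notin crossings_from s L ->
  ((a, c) \in crossings_from s L) || ((c, b) \in crossings_from s L).
Proof.
elim: L s => [|k L IHL] s //= acb.
rewrite !inE !negb_or !xpair_eqE ![_ == s _]eq_sym !(permV_eq s).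
move=> abL /andP[nba baL].
case ack: (_ && _) => //=; case cbk: (_ && _) => /=; first by rewrite orbT.
apply: IHL => //; first by rewrite !apply_bar_inv cyclic_order_tperm ?ack ?cbk // andbC.
(* The first bar cannot swap [a] with [b]: they would be on adjacent lines, with no line left for
   [c]. *)
case/orP: abL => // /andP[/eqP ak /eqP bk]; move: acb; rewrite ak bk.
rewrite /cyclic_order val_ordS; have := ltn_ord k; have := ltn_ord ((s^-1)%g c).
by case: eqP; lia.
Qed.

(** * Reduced diagrams and their moves *)

Definition reduced s L := forall i j, i != j ->
  count (fun x => (x == (i, j)) || (x == (j, i))) (crossings_from s L) <= 1.

Lemma reduced_behead s k L : reduced s (k :: L) -> reduced (apply_bar s k) L.
Proof. by move=> + i j ij => /(_ i j ij) /=; lia. Qed.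

Lemma reduced_head s k L : 1 < n -> reduced s (k :: L) ->
  (s k, s (ordS k)) \notin crossings_from (apply_bar s k) L /\
  (s (ordS k), s k) \notin crossings_from (apply_bar s k) L.
Proof.
move=> n1 /(_ (s k) (s (ordS k))); rewrite (inj_eq perm_inj) neq_ordS // => /(_ isT) /=.
rewrite eqxx /= add1n ltnS leqn0 -leqn0 leqNgt -has_count -all_predC => /allP h.
by split; apply/negP => /h; rewrite /= eqxx ?orbT.
Qed.

Lemma reduced_swap s L a b : 1 < n -> reduced s L ->
  (a, b) \in crossings_from s L -> (b, a) \notin crossings_from s L.
Proof.
move=> n1; elim: L s => [|k L IHL] s //= rL.
have [h1 h2] := reduced_head n1 rL; have {}IHL := IHL _ (reduced_behead rL).
rewrite !inE => /predU1P[[-> ->]|ab].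
  rewrite negb_or h2 andbT xpair_eqE !(inj_eq perm_inj) negb_and.
  by rewrite eq_sym neq_ordS.
rewrite negb_or IHL // andbT; apply/eqP => -[eb ea].
by move: h2; rewrite -ea -eb ab.
Qed.

(** Diagrams are sequences, so exchanging two bars without a common line is a move of its own here,
    although the arrangement stays the same. *)
Inductive braid_step : diagram n -> diagram n -> Prop :=
| CommStep u v j k : j != k -> j != ordS k -> ordS j != k ->
    braid_step (u ++ [:: j; k] ++ v) (u ++ [:: k; j] ++ v)
| BraidStep L M : braid_bars L M -> braid_step L M
| BraidStepV L M : braid_bars M L -> braid_step L M.

Inductive braid_equiv : diagram n -> diagram n -> Prop :=
| BraidRefl L : braid_equiv L L
| BraidTrans L M N : braid_step L M -> braid_equiv M N -> braid_equiv L N.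

Lemma braid_equiv_trans L M N :
  braid_equiv L M -> braid_equiv M N -> braid_equiv L N.
Proof. by elim=> // {}L {}M M' LM _ IH /IH; apply: BraidTrans. Qed.

Lemma braid_equiv_step L M : braid_step L M -> braid_equiv L M.
Proof. by move=> LM; apply: BraidTrans LM (BraidRefl M). Qed.

Lemma braid_bars_cons k L M : braid_bars L M -> braid_bars (k :: L) (k :: M).
Proof. by case=> n2 [u] [v] [j] [-> ->]; split=> //; exists (k :: u), v, j. Qed.

Lemma braid_equiv_cons k L M : braid_equiv L M -> braid_equiv (k :: L) (k :: M).
Proof.
elim=> [N|{}L {}M N LM _]; first exact: BraidRefl.
apply: BraidTrans; case: LM => [u v i j ij iSj Sij|{}L {}M LM|{}L {}M LM].
- exact: (CommStep (k :: u)).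
- exact/BraidStep/braid_bars_cons.
- exact/BraidStepV/braid_bars_cons.
Qed.

(** A braid relation lists the same three directed crossings in the reverse order. *)
Lemma braid_bars_crossings s L M : braid_bars L M ->
  perm_eq (crossings_from s L) (crossings_from s M) /\
  foldl (@apply_bar n) s L = foldl (@apply_bar n) s M.
Proof.
case=> n2 [u] [v] [k] [-> ->].
rewrite !crossings_from_cat !foldl_cat perm_cat2l; move: (foldl _ s u) => {}s.
rewrite /= apply_bar_braid //; split=> //.
have k1 : k != ordS k by apply/neq_ordS/ltnW.
have k2 : ordS k != ordS (ordS k) by apply/neq_ordS/ltnW.
have k3 := neq_ordSS k n2.
rewrite !apply_barE.
have t1 : tperm (ordS k) (ordS (ordS k)) k = k by rewrite tpermD // eq_sym.
have t2 : tperm k (ordS k) (ordS (ordS k)) = ordS (ordS k) by rewrite tpermD.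
by rewrite !(t1, t2, tpermL, tpermR); apply/seq.permP => P /=; lia.
Qed.

(** The exchanged crossings [x] and [y] share no element; hence no pseudoline sees the exchange. *)
Lemma crossings_from_comm s j k u v :
  j != k -> j != ordS k -> ordS j != k ->
  exists C C' x y,
  [/\ crossings_from s (u ++ [:: j; k] ++ v) = C ++ [:: x; y] ++ C',
      crossings_from s (u ++ [:: k; j] ++ v) = C ++ [:: y; x] ++ C',
      [&& x.1 != y.1, x.1 != y.2, x.2 != y.1 & x.2 != y.2] &
      foldl (@apply_bar n) s (u ++ [:: j; k] ++ v)
      = foldl (@apply_bar n) s (u ++ [:: k; j] ++ v)].
Proof.
move=> jk jSk Sjk; have SjSk : ordS j != ordS k by rewrite (inj_eq (@ordS_inj n)).
rewrite !crossings_from_cat !foldl_cat /=.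
set t := foldl _ s u; rewrite (apply_bar_comm t jk jSk Sjk).
exists (crossings_from s u), (crossings_from (apply_bar (apply_bar t k) j) v).
exists (t j, t (ordS j)), (t k, t (ordS k)); split=> //.
- by rewrite !apply_barE !tpermD.
- by rewrite !apply_barE !tpermD // eq_sym.
- by rewrite !(inj_eq perm_inj) jk jSk Sjk.
Qed.

Lemma braid_equiv_crossings s L M : braid_equiv L M ->
  perm_eq (crossings_from s L) (crossings_from s M) /\
  foldl (@apply_bar n) s L = foldl (@apply_bar n) s M.
Proof.
elim=> // {}L {}M N LM _ [pMN <-].
suff [pLM ->] : perm_eq (crossings_from s L) (crossings_from s M) /\
    foldl (@apply_bar n) s L = foldl (@apply_bar n) s M.
  by split=> //; apply: perm_trans pMN.
case: LM {pMN} => [u v j k jk jSk Sjk|{}L {}M|{}L {}M].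
- have [C [C' [x [y [-> -> _ ->]]]]] := crossings_from_comm s u v jk jSk Sjk.
  by rewrite perm_cat2l (perm_cat2r C' [:: x; y]) (perm_catC [:: x] [:: y]).
- exact: braid_bars_crossings.
- by case/(braid_bars_crossings s) => pML ->; rewrite perm_sym.
Qed.

Lemma size_crossings_from s L : size (crossings_from s L) = size L.
Proof. by elim: L s => //= k L IHL s; rewrite IHL. Qed.

Lemma braid_equiv_size L M : braid_equiv L M -> size L = size M.
Proof.
case/(braid_equiv_crossings 1%g) => /perm_size.
by rewrite !size_crossings_from.
Qed.

Lemma braid_equiv_reduced s L M : braid_equiv L M -> reduced s L -> reduced s M.
Proof.
case/(braid_equiv_crossings s) => /seq.permP pLM _ rL i j ij.
by rewrite -pLM; apply: rL.
Qed.

(** * The exchange property *)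

Lemma neq_ordSS_gt2 k : 1 < n -> k != ordS (ordS k) -> 2 < n.
Proof.
move=> n1; apply: contraNT => n2; rewrite ord_eqE !val_ordS.
by have := ltn_ord k; do ?[case: eqP]; lia.
Qed.

Lemma cyclic_order_ordS k : 2 < n -> cyclic_order k (ordS k) (ordS (ordS k)).
Proof.
move=> n2; rewrite /cyclic_order !val_ordS.
by have := ltn_ord k; case: eqP; case: eqP; lia.
Qed.

(** The induction is on the length because it is also applied to tails that have already been
    rewritten. *)
Lemma braid_equiv_exchange s L k : 1 < n -> reduced s L ->
  (s k, s (ordS k)) \in crossings_from s L ->
  exists L0, braid_equiv L (k :: L0).
Proof.
move=> n1; have [m] := ubnP (size L); elim: m s L k => // m IHm s [//|j L] k /=.
rewrite ltnS => Lm rL; have [r1 r2] := reduced_head n1 rL.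
have rL' := reduced_behead rL.
have [-> _|jk] := eqVneq j k; first by exists L; apply: BraidRefl.
rewrite inE xpair_eqE !(inj_eq perm_inj) [k == j]eq_sym (negbTE jk) /= => abL.
have kSk := neq_ordS k n1; have jSj := neq_ordS j n1.
have baL := reduced_swap n1 rL' abL.
have [ejk|jSk] := eqVneq j (ordS k).
  subst j.
  (* For n = 2 the bars [k] and [ordS k] swap the same two elements, which may cross only once. *)
  have kSSk : k != ordS (ordS k).
    by apply/eqP => ek; move: r2; rewrite -ek abL.
  have n2 := neq_ordSS_gt2 n1 kSSk.
  (* The first bar has put [s (ordS (ordS k))] between the two. By [r2] it does not cross
     [s (ordS k)] again, so it must cross [s k]. *)
  have acL : (s k, s (ordS (ordS k))) \in crossings_from (apply_bar s (ordS k)) L.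
    have := @crossings_from_sandwich _ _ _ _ (s (ordS (ordS k))) _ abL baL.
    rewrite (negbTE r2) orbF; apply.
    rewrite !apply_bar_inv !permK tpermD 1?eq_sym // tpermL tpermR.
    exact: cyclic_order_ordS.
  have [L1 LL1] : exists L1, braid_equiv L (k :: L1).
    apply: (IHm _ _ _ _ rL') => //.
    by rewrite !apply_barE tpermL tpermD // eq_sym.
  have rL1 := braid_equiv_reduced LL1 rL'.
  have [pL1 _] := braid_equiv_crossings (apply_bar s (ordS k)) LL1.
  (* After the bars [ordS k] and [k], the original pair is on lines [ordS k] and [ordS (ordS k)]. *)
  have [L2 LL2] : exists L2, braid_equiv L1 (ordS k :: L2).
    apply: (IHm (apply_bar (apply_bar s (ordS k)) k)).
    - by have := braid_equiv_size LL1 => /= e; rewrite -e ltnW // e.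
    - exact: reduced_behead rL1.
    - move: abL; rewrite (perm_mem pL1) inE /= !apply_barE.
      have t1 : tperm (ordS k) (ordS (ordS k)) k = k by rewrite tpermD // eq_sym.
      have t2 : tperm k (ordS k) (ordS (ordS k)) = ordS (ordS k) by rewrite tpermD.
      rewrite !(t1, t2, tpermL, tpermR).
      by rewrite xpair_eqE !(inj_eq perm_inj) (negbTE jSj) andbF.
  exists (ordS k :: k :: L2).
  have LL3 := braid_equiv_cons (ordS k) (braid_equiv_trans LL1 (braid_equiv_cons _ LL2)).
  apply: (braid_equiv_trans LL3).
  by apply/braid_equiv_step/BraidStepV; split=> //; exists [::], L2, k.
(* The mirror image: now [s j] comes between the two and must cross the right one. *)
have [ejk|Sjk] := eqVneq (ordS j) k.
  subst k.
  have jSSj : j != ordS (ordS j).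
    by apply/eqP => ej; move: r2; rewrite {2}ej abL.
  have n2 := neq_ordSS_gt2 n1 jSSj.
  have cbL : (s j, s (ordS (ordS j))) \in crossings_from (apply_bar s j) L.
    have := @crossings_from_sandwich _ _ _ _ (s j) _ abL baL.
    rewrite (negbTE r2) /=; apply.
    rewrite !apply_bar_inv !permK [tperm _ _ (ordS (ordS j))]tpermD // tpermL tpermR.
    exact: cyclic_order_ordS.
  have [L1 LL1] : exists L1, braid_equiv L (ordS j :: L1).
    by apply: (IHm _ _ _ _ rL') => //; rewrite !apply_barE tpermR tpermD.
  have rL1 := braid_equiv_reduced LL1 rL'.
  have [pL1 _] := braid_equiv_crossings (apply_bar s j) LL1.
  have [L2 LL2] : exists L2, braid_equiv L1 (j :: L2).
    apply: (IHm (apply_bar (apply_bar s j) (ordS j))).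
    - by have := braid_equiv_size LL1 => /= e; rewrite -e ltnW // e.
    - exact: reduced_behead rL1.
    - move: abL; rewrite (perm_mem pL1) inE /= !apply_barE.
      have t1 : tperm (ordS j) (ordS (ordS j)) j = j by rewrite tpermD // eq_sym.
      have t2 : tperm j (ordS j) (ordS (ordS j)) = ordS (ordS j) by rewrite tpermD.
      rewrite !(t1, t2, tpermL, tpermR).
      by rewrite xpair_eqE !(inj_eq perm_inj) [ordS j == j]eq_sym (negbTE jSj).
  exists (j :: ordS j :: L2).
  have LL3 := braid_equiv_cons j (braid_equiv_trans LL1 (braid_equiv_cons _ LL2)).
  apply: (braid_equiv_trans LL3).
  by apply/braid_equiv_step/BraidStep; split=> //; exists [::], L2, j.
have [L0 LL0] : exists L0, braid_equiv L (k :: L0).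
  apply: (IHm _ _ _ _ rL') => //; rewrite !apply_barE !tpermD //.
  by rewrite (inj_eq (@ordS_inj n)).
exists (j :: L0); apply: braid_equiv_trans (braid_equiv_cons _ LL0) _.
by apply: braid_equiv_step; apply: (CommStep [::]).
Qed.

(** * Displacements determine the braid class *)

Lemma displacement_perm C C' e :
  perm_eq C C' -> displacement C e = displacement C' e.
Proof. by move/seq.permP=> pC; rewrite /displacement !pC. Qed.

(** By [gap_foldl] the count of [(a, b)] minus that of [(b, a)] is the same for [L] and [L']. For a
    crossing of the reduced [L'] it is positive, so [(a, b)] occurs in [L]. *)
Lemma crossings_from_displacement s L L' : 1 < n ->
  reduced s L' ->
  foldl (@apply_bar n) s L = foldl (@apply_bar n) s L' ->
  (forall e, displacement (crossings_from s L) e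
             = displacement (crossings_from s L') e) ->
  {subset crossings_from s L' <= crossings_from s L}.
Proof.
move=> n1 rL' eLL' dLL' [a b] abL'.
have baL' := reduced_swap n1 rL' abL'.
have ab : a != b by apply: contraNneq baL' => ab; move: abL'; rewrite ab.
have := gap_foldl s L n1 ab; rewrite eLL' gap_foldl // !dLL'.
move: (count_memPn baL') => ->; move: abL'; rewrite -!has_pred1 !has_count.
set x := count _ _; set y := count _ _; set z := count _ _.
by have [->|//] := posnP y; nia.
Qed.

Lemma braid_equiv_displacement s L L' : 1 < n ->
  reduced s L -> reduced s L' ->
  foldl (@apply_bar n) s L = foldl (@apply_bar n) s L' ->
  (forall e, displacement (crossings_from s L) e
             = displacement (crossings_from s L') e) ->
  braid_equiv L L'.
Proof.
move=> n1; elim: L' s L => [|k L' IHL'] s L rL rL' eLL' dLL'.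
  case: L rL eLL' dLL' => [|k L] rL eLL' dLL'; first exact: BraidRefl.
  (* With the roles exchanged, the first crossing of a nonempty [L] would have to occur in the empty
     diagram. *)
  have := @crossings_from_displacement s [::] (k :: L) n1 rL (esym eLL').
  by move/(_ (fun e => esym (dLL' e)) (s k, s (ordS k))); rewrite mem_head => /(_ isT).
have [|L0 LL0] := @braid_equiv_exchange s L k n1 rL.
  by apply: (crossings_from_displacement n1 rL' eLL' dLL'); rewrite mem_head.
have [pL0 eL0] := braid_equiv_crossings s LL0.
have rL0 := reduced_behead (braid_equiv_reduced LL0 rL).
apply: braid_equiv_trans LL0 (braid_equiv_cons _ _).
apply: (IHL' (apply_bar s k)).
- exact: rL0.
- exact: reduced_behead rL'.
- by move: eLL'; rewrite eL0.
- move=> e; have := dLL' e; rewrite (displacement_perm e pL0) /displacement /=; lia.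
Qed.

(** * From moves on diagrams to reachability of arrangements *)

Lemma braid_equiv_LL1 (pi : 'S_n) L M : 1 < n ->
  braid_equiv L M -> in_LL1 pi L -> in_LL1 pi M.
Proof.
move=> n1 LM [[_ bL] rL]; split; last exact: (braid_equiv_reduced (s := 1%g)) LM rL.
split; first by apply/allP => k _; apply: neq_ordS.
by have [_] := braid_equiv_crossings 1%g LM; rewrite /bottom => <-.
Qed.

(** Only braid moves lengthen the sequence; a commutation is absorbed by [same_arrangement] at its
    start. *)
Lemma reachable_braid_equiv (pi : 'S_n) L M : 1 < n ->
  braid_equiv L M -> in_LL1 pi L -> reachable pi L M.
Proof.
move=> n1; elim=> [N hN|{}L {}M N LM _ IH hL]; first by exists 0, (fun=> N).
have hM := braid_equiv_LL1 n1 (braid_equiv_step LM) hL.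
have [t [Ls [hLs MLs LsN steps]]] := IH hM.
have prepend : braid_bars L M \/ braid_bars M L -> reachable pi L N.
  move=> LM'; exists t.+1, (fun i => if i is j.+1 then Ls j else L).
  split=> // [[|i] it //|[|i] it]; [exact: hLs| |exact: steps].
  by exists L, M; split.
case: LM MLs {IH} hL hM prepend => [u v j k jk jSk Sjk|{}L {}M LM|{}L {}M LM];
  try by move=> _ _ _; apply; auto.
move=> MLs _ _ _; exists t, Ls; split=> // i; rewrite -MLs.
have [C [C' [x [y [eL eM]]]]] := crossings_from_comm 1%g u v jk jSk Sjk.
rewrite /pl /crossings eL eM => /and4P[xy11 xy12 xy21 xy22] _.
rewrite !filter_cat; congr (_ ++ (_ ++ _)) => /=.
(* Their order matters only if both crossings involve [i], which disjointness excludes. *)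
case: ifP => // ix; case: ifP => // iy; move: ix iy xy11 xy12 xy21 xy22.
by move=> /orP[]/eqP-> /orP[]/eqP->; rewrite eqxx.
Qed.

(** Every bar that moves [e] lies on its pseudoline; this makes [DV] an invariant of the
    arrangement. *)
Lemma displacement_pl L e : displacement (pl L e) e = displacement (crossings L) e.
Proof.
rewrite /displacement !count_filter.
by congr (Posz _ - Posz _)%R; apply: eq_count => x /=; case: eqP; rewrite ?orbT ?andbF.
Qed.

Lemma DV_eqP L M :
  DV L = DV M <->
  forall e, displacement (crossings L) e = displacement (crossings M) e.
Proof.
split=> [/rowP LM e|LM]; first by have := LM e; rewrite !mxE.
by apply/rowP=> e; rewrite !mxE; apply: LM.
Qed.

Lemma same_arrangement_DV L M : same_arrangement L M -> DV L = DV M.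
Proof. by move=> LM; apply/DV_eqP => e; rewrite -!displacement_pl LM. Qed.

Lemma braid_bars_DV L M : braid_bars L M -> DV L = DV M.
Proof.
by case/(braid_bars_crossings 1%g) => pLM _; apply/DV_eqP => e; apply: displacement_perm.
Qed.

Lemma reachable_DV (pi : 'S_n) L M : reachable pi L M -> DV L = DV M.
Proof.
case=> t [Ls [_ /same_arrangement_DV-> /same_arrangement_DV<- steps]].
elim: t steps => // t IHt steps.
rewrite IHt => [|i it]; last exact/steps/ltnW.
have [N [N' [/same_arrangement_DV-> NN' /same_arrangement_DV<-]]] := steps t (ltnSn t).
by case: NN' => /braid_bars_DV.
Qed.

Lemma lottery_nil (pi : 'S_n) L : n <= 1 -> is_lottery pi L -> L = [::].
Proof.
move=> n1 [+ _]; case: L => [//|k L] /= /andP[+ _]; rewrite ord_eqE val_ordS.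
by have := ltn_ord k; do ?[case: eqP]; lia.
Qed.

End Braids.

Theorem theorem1 (n : nat) (pi : 'S_n) (L L' : diagram n)
    (hL : in_LL1 pi L) (hL' : in_LL1 pi L') :
  DV L = DV L' <-> reachable pi L L'.
Proof.
split; last exact: reachable_DV.
have [n1 _|n1 dLL'] := leqP n 1.
  (* With at most one line there are no bars, and the constant sequence of length zero serves. *)
  rewrite (lottery_nil n1 hL'.1) (lottery_nil n1 hL.1).
  by exists 0, (fun=> L); split=> //; rewrite (lottery_nil n1 hL.1).
apply: reachable_braid_equiv => //; apply: (@braid_equiv_displacement _ 1%g) => //.
- exact: hL.2.
- exact: hL'.2.
- by have [_ +] := hL.1; have [_ <-] := hL'.1.
- exact/DV_eqP.
Qed.
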